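(* Let $q$ be a power of a prime $p>2$, and let $A,B,C\in\mathbb{F}_q$ with $A,B\neq 0$. Let $h_{A,B,C}(x)=Bx^3+Cx^2+x+A$ and $\widetilde{h}_{A,B,C}(x)=Ax^3+x^2+Cx+B$. Then the function $$f_{A,B,C}(x)=\frac{\widetilde{h}_{A,B,C}(x)}{h_{A,B,C}(x)}$$ permutes $\mu_{q+1}$ in each of the following cases: (1) $A^2-AC-B^2+B=0$, and the polynomial $AT^2+(1-B)T+A\in\mathbb{F}_q[T]$ has distinct roots in $\mathbb{F}_q$; (2) $q\equiv 1\pmod 3$, $B=(3AC+C^2-1)/3$, and the polynomial $3T^2-3(3A+C)T+(3A+C)^2-1\in\mathbb{F}_q[T]$ has distinct roots in $\mathbb{F}_q$.
   Context: $\mu_{q+1}=\{x\in\mathbb{F}_{q^2}: x^{q+1}=1\}$ is the group of $(q+1)$-th roots of unity in $\mathbb{F}_{q^2}$. For a polynomial $h(x)=\sum_{i=0}^{\ell}a_ix^i$ of degree $\ell$, $\widetilde{h}(x)=\sum_{i=0}^{\ell}a_{\ell-i}x^i$ is the reciprocal polynomial. A rational function ''permutes'' a set $S$ if it induces a bijection of $S$ onto itself; the rational function is understood as an element of the field of rational functions, i.e. common factors of numerator and denominator may be cancelled.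
   Formalization: The formal theorem assumes in addition that f_{A,B,C} is not a constant rational function; without this the claim fails, e.g. q=5, A=B=C=1 satisfies (1) but f=1 after cancellation, which does not permute μ_6. *)

(* Defs.v *)
From mathcomp Require Import all_boot all_order all_algebra.

Set Implicit Arguments.
Unset Strict Implicit.
Unset Printing Implicit Defensive.

Import GRing.Theory.
Local Open Scope ring_scope.

(* [recip h] is defined without reference to a nominal degree: its degree drops
   when [h] has constant coefficient 0. *)
Definition recip (F : nzRingType) (h : {poly F}) : {poly F} :=
  \poly_(i < size h) h`_(size h - i.+1).

Definition hABC (F : nzRingType) (A B C : F) : {poly F} :=
  B *: 'X^3 + C *: 'X^2 + 'X + A%:P.

Definition hABC_recip (F : nzRingType) (A B C : F) : {poly F} :=
  A *: 'X^3 + 'X^2 + C *: 'X + B%:P.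

Lemma size_hABC (F : nzRingType) (A B C : F) :
  B != 0 -> size (hABC A B C) = 4.
Proof.
move=> B0; have -> : hABC A B C = Poly [:: A; 1; C; B].
  by apply/polyP=> i; rewrite coef_Poly !(coefE, coefXn);
     case: i => [|[|[|[|i]]]];
     rewrite /= ?nth_nil ?mulr0 ?mulr1 ?add0r ?addr0.
by rewrite (PolyK (c := A)).
Qed.

Lemma recip_hABC (F : nzRingType) (A B C : F) :
  B != 0 -> recip (hABC A B C) = hABC_recip A B C.
Proof.
move=> B0; apply/polyP=> i; rewrite coef_poly size_hABC //.
by rewrite !(coefE, coefXn);
   case: i => [|[|[|[|i]]]]; rewrite /= ?mulr0 ?mulr1 ?add0r ?addr0.
Qed.

Definition fABC (F : fieldType) (A B C : F) : {fraction {poly F}} :=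
  tofrac (hABC_recip A B C) / tofrac (hABC A B C).

Definition mu (L : finFieldType) (n : nat) : {set L} :=
  [set x : L | x ^+ n == 1].

(* The numerator and denominator below range over all representations of [f],
   in particular the reduced one, so common factors are cancelled. *)
Definition ratfun_value (F L : fieldType) (iota : {rmorphism F -> L})
    (f : {fraction {poly F}}) (x y : L) : Prop :=
  exists n d : {poly F},
    [/\ f = tofrac n / tofrac d,
        (map_poly iota d).[x] != 0
      & y = (map_poly iota n).[x] / (map_poly iota d).[x]].

Definition ratfun_permutes (F : fieldType) (L : finFieldType)
    (iota : {rmorphism F -> L}) (f : {fraction {poly F}}) (S : {set L}) : Prop :=
  exists g : L -> L,
    [/\ forall x, x \in S -> ratfun_value iota f x (g x),
        {in S &, injective g}
      & g @: S = S].

(* Only meant for polynomials of degree 2, where two distinct roots are all. *)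
Definition has_distinct_roots (F : fieldType) (P : {poly F}) : Prop :=
  exists r s : F, [/\ r != s, root P r & root P s].

(* [fABC A B C] is constant exactly when [B = A, C = 1] (value 1) or
   [B = - A, C = - 1] (value -1).  Such A, B, C can satisfy the conditions under
   which [fABC A B C] otherwise permutes [mu L #|F|.+1], so they have to be
   excluded separately. *)
Definition nonconstant (F : fieldType) (f : {fraction {poly F}}) : Prop :=
  forall c : F, f <> tofrac c%:P.

(* Main.v *)
Require Import Defs.
From mathcomp Require Import all_boot all_order all_algebra.
From mathcomp Require Import fingroup pgroup finfield ring.

Set Implicit Arguments.
Unset Strict Implicit.

Import GRing.Theory.
Local Open Scope ring_scope.

(** Write [mobius u w x = (u x + w) / (w x + u)].  With [u, w] in [F_q] and
    [u^2 <> w^2] it permutes [mu_{q+1}], since [x^q = x^-1] there; below,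
    [u^2 = w^2] would make [f] one of the constants [1] and [-1].

    In case (1) [h] and its reciprocal have the common factor
    [A x^2 + (1 - B) x + A], and cancelling it leaves [mobius A B].

    In case (2) the Hessian of the binary cubic form attached to [h] is
    proportional to [x^2 + D x + 1] with [D = 3 A + C].  The quadratic
    polynomial of the hypothesis has discriminant [3 (4 - D^2)] and [-3] is a
    square because [3 | q - 1], so the Hessian splits over [F_q] with roots
    [- v] and [- v^-1].  Hence [h = d (x + v)^3 + c (v x + 1)^3] and
    [f = mobius c d \o (fun x => x^3) \o mobius 1 v], where cubing permutes
    [mu_{q+1}] because [3] is coprime to [q + 1]. *)

Lemma inj_imset_eq (T : finType) (S : {set T}) (g : T -> T) :
  {in S &, injective g} -> {in S, forall x, g x \in S} -> g @: S = S.
Proof.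
move=> injg gS; apply/eqP; rewrite eqEcard card_in_imset // leqnn andbT.
by apply/subsetP=> _ /imsetP[x xS ->]; apply: gS.
Qed.

Definition mobius (L : fieldType) (u w x : L) : L := (u * x + w) / (w * x + u).

Lemma mobius_inj (L : fieldType) (u w x y : L) :
  u ^+ 2 != w ^+ 2 -> w * x + u != 0 -> w * y + u != 0 ->
  mobius u w x = mobius u w y -> x = y.
Proof.
move=> uw Dx Dy /eqP; rewrite eqr_div // => /eqP E.
have : (u ^+ 2 - w ^+ 2) * (x - y) = 0.
  transitivity ((u * x + w) * (w * y + u) - (u * y + w) * (w * x + u));
    first by ring.
  by rewrite E subrr.
by move/eqP; rewrite mulf_eq0 !subr_eq0 (negPf uw) => /eqP.
Qed.

Section MobiusOnMu.

Context (L : finFieldType) (q : nat).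
Context (frobD : {morph (fun z : L => z ^+ q) : x y / x + y}).

(** The [q]-th power map fixes [u] and [w] and inverts [x], so it exchanges numerator and
    denominator up to the factor [x]. *)
Lemma mobius_conj (u w x : L) :
  u ^+ q = u -> w ^+ q = w -> x \in mu L q.+1 ->
  (w * x + u) ^+ q * x = u * x + w.
Proof.
move=> uq wq; rewrite inE exprSr => /eqP xq.
by rewrite [(w * x + u) ^+ q]frobD exprMn uq wq mulrDl -mulrA xq mulr1 addrC.
Qed.

(** By [mobius_conj] a zero of the denominator is also a zero of the numerator, and [u^2 - w^2] is a
    linear combination of the two. *)
Lemma mobius_den_neq0 (u w x : L) :
  (0 < q)%N -> u ^+ q = u -> w ^+ q = w -> u ^+ 2 != w ^+ 2 ->
  x \in mu L q.+1 -> w * x + u != 0.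
Proof.
move=> q0 uq wq uw xmu; apply/eqP=> D0.
have := mobius_conj uq wq xmu; rewrite D0 expr0n gtn_eqF // mul0r => N0.
case/eqP: uw; apply/eqP; rewrite -subr_eq0; apply/eqP.
transitivity (u * (w * x + u) - w * (u * x + w)); first by ring.
by rewrite D0 -N0 !mulr0 subr0.
Qed.

(** For numerator [N] and denominator [D], [mobius_conj] gives [D^q x = N] and [N^q x = D], hence
    [N^(q+1) = N^q D^q x = D^(q+1)]. *)
Lemma mobius_mu (u w x : L) :
  (0 < q)%N -> u ^+ q = u -> w ^+ q = w -> u ^+ 2 != w ^+ 2 ->
  x \in mu L q.+1 -> mobius u w x \in mu L q.+1.
Proof.
move=> q0 uq wq uw xmu; have D0 := mobius_den_neq0 q0 uq wq uw xmu.
have HD := mobius_conj uq wq xmu; have HN := mobius_conj wq uq xmu.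
rewrite inE /mobius expr_div_n -subr_eq0 -(divff (expf_neq0 q.+1 D0)) -mulrBl.
rewrite mulf_eq0 invr_eq0 expf_eq0 (negPf D0) orbF subr_eq0 !exprSr.
apply/eqP; transitivity ((u * x + w) ^+ q * ((w * x + u) ^+ q * x)).
  by rewrite HD.
by rewrite mulrCA HN.
Qed.

Lemma cube_mu_inj :
  (q = 1 %[mod 3])%N -> {in mu L q.+1 &, injective (fun x => x ^+ 3)}.
Proof.
move=> q3 x y; rewrite !inE => /eqP xq /eqP yq.
(* The exponent is [(q + 2) / 3]; it undoes cubing because [x^(q+2) = x] on [mu L q.+1]. *)
move/(congr1 (fun z => z ^+ (q %/ 3).+1)); rewrite -!exprM.
have -> : (3 * (q %/ 3).+1 = q.+2)%N.
  by rewrite mulnS mulnC [in RHS](divn_eq q 3) q3 addnC -[RHS]addn2 -addnA.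
by rewrite !(exprS _ q.+1) xq yq !mulr1.
Qed.

Lemma cube_mu (x : L) : x \in mu L q.+1 -> x ^+ 3 \in mu L q.+1.
Proof. by rewrite !inE exprAC => /eqP ->; rewrite expr1n. Qed.

End MobiusOnMu.

Lemma frobenius_add (L : finFieldType) (p n : nat) :
  p \in [pchar L] -> {morph (fun z : L => z ^+ (p ^ n)%N) : x y / x + y}.
Proof.
move=> pL x y; apply: exprDn_pchar.
by rewrite (eq_pnat _ (pcharf_eq pL)) pnatX pnat_id ?(pcharf_prime pL).
Qed.

(** If also [C = e], the reciprocal is [e] times [h], so [f] is the constant [e]. Both cases use
    this to get [u^2 <> w^2]. *)
Lemma nonconstant_fABC (F : fieldType) (A B C e : F) :
  B != 0 -> nonconstant (fABC A B C) -> e ^+ 2 = 1 -> B = e * A -> C != e.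
Proof.
move=> B0 hf e2 BA; apply/eqP=> Ce; apply: (hf e); rewrite /fABC.
have h0 : hABC A B C != 0 by rewrite -size_poly_eq0 size_hABC.
suff -> : hABC_recip A B C = e%:P * hABC A B C.
  by rewrite tofracM mulfK // tofrac_eq0.
rewrite /hABC_recip /hABC -!mul_polyC BA Ce.
have e2P : e%:P * e%:P = 1 :> {poly F} by rewrite -polyCM -expr2 e2.
by rewrite !rmorphM /= !mulrDr !mulrA e2P !mul1r.
Qed.

Lemma cube_root_unity (F : finFieldType) :
  (#|F| = 1 %[mod 3])%N -> exists w : F, w ^+ 2 + w + 1 = 0.
Proof.
move=> F3; have d3 : (3 %| #|[set: {unit F}]|)%N.
  rewrite card_finField_unit -subn1 -eqn_mod_dvd ?F3 //.
  by apply/card_gt0P; exists 0.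
have [u _ ou] := Cauchy (isT : prime 3) d3.
exists (val u); set w := val u.
have w3 : w ^+ 3 = 1 by rewrite /w -FinRing.val_unitX -ou expg_order.
have w1 : w != 1.
  by apply/eqP=> w1; move: ou; rewrite (_ : u = 1%g) ?order1 //; apply: val_inj.
have : (w - 1) * (w ^+ 2 + w + 1) = 0 by rewrite -[RHS](subrr 1) -{3}w3; ring.
by move/eqP; rewrite mulf_eq0 subr_eq0 (negPf w1) => /eqP.
Qed.

Lemma quadratic_splits (F : finFieldType) (D r s : F) :
  (#|F| = 1 %[mod 3])%N -> 3%:R != 0 :> F -> r != s ->
  root (3%:R *: 'X^2 - (3%:R * D) *: 'X + (D ^+ 2 - 1)%:P) r ->
  root (3%:R *: 'X^2 - (3%:R * D) *: 'X + (D ^+ 2 - 1)%:P) s ->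
  exists2 v : F, v ^+ 2 + 1 = D * v & v ^+ 2 != 1.
Proof.
move=> F3 n3 rs /rootP; rewrite !(hornerD, hornerN, hornerZ, hornerXn, hornerX).
move=> + /rootP; rewrite !(hornerD, hornerN, hornerZ, hornerXn, hornerX) !hornerC.
move=> Er Es.
have [w Ew] := cube_root_unity F3.
have ED : D = r + s.
  have : 3%:R * (r - s) * (r + s - D) = 0.
    by rewrite -[RHS](subrr 0) -{1}Er -Es; ring.
  by move/eqP; rewrite !mulf_eq0 (negPf n3) !subr_eq0 (negPf rs) => /eqP.
have rs1 : r ^+ 2 - r * s + s ^+ 2 = 1.
  by apply/eqP; rewrite -subr_eq0 -Er ED; apply/eqP; ring.
(* By [ED] and [rs1], [T^2 - D T + 1] becomes [T^2 - (r + s) T + r^2 - r s + s^2], whose roots are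
   [r + w (r - s)] for the primitive cube roots of unity [w]. *)
have Ev : (r + w * (r - s)) ^+ 2 + 1 = D * (r + w * (r - s)).
  apply/eqP; rewrite -subr_eq0 -{1}rs1 ED; apply/eqP.
  by transitivity ((w ^+ 2 + w + 1) * (r - s) ^+ 2); [ring | rewrite Ew mul0r].
exists (r + w * (r - s)) => //; apply/eqP=> v2.
have D2 : D ^+ 2 = 4%:R.
  by rewrite -[LHS]mulr1 -[X in _ * X = _]v2 -exprMn -Ev v2; ring.
have : 3%:R * (r - s) ^+ 2 = 0.
  transitivity (4%:R * (r ^+ 2 - r * s + s ^+ 2) - (r + s) ^+ 2); first by ring.
  by rewrite rs1 -ED D2 mulr1 subrr.
by move/eqP; rewrite mulf_eq0 (negPf n3) expf_eq0 subr_eq0 (negPf rs).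
Qed.

(** These are the four coefficients of [h = d (x + v)^3 + c (v x + 1)^3]. Those of [x] and [x^2]
    form a linear system that determines [c] and [d], as [v^2 <> 1]; the other two then follow from
    [BE] and [Ev]. *)
Lemma hABC_sum_cubes (F : fieldType) (A B C v : F) :
  3%:R != 0 :> F -> B = (3%:R * A * C + C ^+ 2 - 1) / 3%:R ->
  v ^+ 2 + 1 = (3%:R * A + C) * v -> v ^+ 2 != 1 ->
  exists c d : F, [/\ A = d * v ^+ 3 + c, B = d + c * v ^+ 3,
    C = 3%:R * v * (d + c * v) & 1 = 3%:R * v * (d * v + c)].
Proof.
move=> n3 BE Ev v21; have v0 : v != 0.
  by apply/eqP=> v0; move/eqP: Ev; rewrite v0 expr0n mulr0 add0r oner_eq0.
have w0 : 1 - v ^+ 2 != 0 by rewrite subr_eq0 eq_sym.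
have E3A : 3%:R * A = (v ^+ 2 + 1) / v - C.
  by rewrite Ev mulfK // addrK.
have AE : A = ((v ^+ 2 + 1) / v - C) / 3%:R by rewrite -E3A mulrAC divff ?mul1r.
exists ((1 - v * C) / (3%:R * v * (1 - v ^+ 2))).
exists ((C - v) / (3%:R * v * (1 - v ^+ 2))).
by split; rewrite ?BE ?AE; field; rewrite ?n3 ?v0 ?w0.
Qed.

Theorem proposition3p2
  (p n q : nat) (hp : prime p) (hp2 : (2 < p)%N) (hn : (0 < n)%N)
  (hq : q = (p ^ n)%N)
  (F L : finFieldType) (hF : #|F| = q) (hL : #|L| = (q ^ 2)%N)
  (iota : {rmorphism F -> L})
  (A B C : F) (hA : A != 0) (hB : B != 0)
  (hf : nonconstant (fABC A B C)) :
  (A ^+ 2 - A * C - B ^+ 2 + B = 0 ->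
   has_distinct_roots (A *: 'X^2 + (1 - B) *: 'X + A%:P) ->
   ratfun_permutes iota (fABC A B C) (mu L q.+1))
  /\
  ((q = 1 %[mod 3])%N ->
   B = (3%:R * A * C + C ^+ 2 - 1) / 3%:R ->
   has_distinct_roots
     (3%:R *: 'X^2 - (3%:R * (3%:R * A + C)) *: 'X
      + ((3%:R * A + C) ^+ 2 - 1)%:P) ->
   ratfun_permutes iota (fABC A B C) (mu L q.+1)).
Proof.
have pF : p \in [pchar F] by apply: (card_finPcharP (n := n)); rewrite // hF.
have frobD : {morph (fun z : L => z ^+ q) : x y / x + y}.
  by rewrite hq; apply/frobenius_add/(rmorph_pchar iota).
have iotaq a : iota a ^+ q = iota a by rewrite -rmorphXn /= -hF expf_card.
have q0 : (0 < q)%N by rewrite hq expn_gt0 prime_gt0.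
have iota_sqr (a b : F) : (iota a ^+ 2 == iota b ^+ 2) = (a ^+ 2 == b ^+ 2).
  by rewrite -!rmorphXn /= (inj_eq (fmorph_inj iota)).
split.
  move=> hABC0 _; have AB : A ^+ 2 != B ^+ 2.
    apply/eqP=> /esym/eqP; rewrite eqf_sqr => AB.
    have [e e2 BA] : exists2 e : F, e ^+ 2 = 1 & B = e * A.
      case/orP: AB => /eqP ->; [exists 1 | exists (- 1)];
        by rewrite ?sqrrN ?expr1n ?mul1r ?mulN1r.
    case/eqP: (nonconstant_fABC hB hf e2 BA).
    (* With [B = e A] and [e^2 = 1] the relation of case (1) collapses to [A (e - C) = 0]. *)
    apply/(mulfI hA)/eqP; rewrite -subr_eq0 -oppr_eq0; apply/eqP.
    rewrite -hABC0 BA exprMn e2; ring.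
  have den x : x \in mu L q.+1 -> iota B * x + iota A != 0.
    by apply: mobius_den_neq0; rewrite ?iota_sqr.
  exists (mobius (iota A) (iota B)); have injg :
      {in mu L q.+1 &, injective (mobius (iota A) (iota B))}.
    by move=> x y xS yS; apply: mobius_inj; rewrite ?iota_sqr ?den.
  split=> // [x xS|]; last first.
    by apply: inj_imset_eq => // x; apply: mobius_mu; rewrite ?iota_sqr.
  (* The reduced fraction, whose denominator is nonzero on [mu L q.+1] by [den]. *)
  exists (A *: 'X + B%:P), (B *: 'X + A%:P).
  have ev u w : (map_poly iota (u *: 'X + w%:P)).[x] = iota u * x + iota w.
    rewrite rmorphD /= map_polyZ /= map_polyX map_polyC /=.
    by rewrite !(hornerD, hornerZ, hornerX, hornerC).
  split; rewrite ?ev ?den //; apply/eqP.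
  have l0 : B *: 'X + A%:P != 0.
    apply: contraNneq hB => /(congr1 (fun P : {poly F} => P`_1)).
    by rewrite !coefE /= mulr1 addr0 => ->.
  rewrite /fABC eqr_div ?tofrac_eq0 -?size_poly_eq0 ?size_hABC ?size_poly_eq0 //.
  rewrite -!tofracM tofrac_eq /hABC_recip /hABC -!mul_polyC -subr_eq0.
  apply/eqP.
  transitivity ((A ^+ 2 - A * C - B ^+ 2 + B)%:P * ('X^3 - 'X)); last first.
    by rewrite hABC0 mul0r.
  by rewrite !rmorphD !rmorphN !rmorphXn !rmorphM /=; ring.
move=> q3 BE [r [s [rs rr rs']]].
have n3 : 3%:R != 0 :> F.
  rewrite -(dvdn_pcharf pF) dvdn_prime2 //; apply: contra_eqN q3 => /eqP p3.
  by rewrite hq p3 -(prednK hn) expnS modnMr.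
have [v Ev v21] : exists2 v : F, v ^+ 2 + 1 = (3%:R * A + C) * v & v ^+ 2 != 1.
  by apply: quadratic_splits rs rr rs'; rewrite ?hF.
have [c [d [EA EB EC E1]]] := hABC_sum_cubes n3 BE Ev v21.
(* If [c = e d] with [e^2 = 1], the coefficient formulas give [B = e A] and [C = e], so [f] would be
   constant. *)
have cd : c ^+ 2 != d ^+ 2.
  rewrite eqf_sqr; apply/negP=> cd.
  have [e e2 ce] : exists2 e : F, e ^+ 2 = 1 & c = e * d.
    case/orP: cd => /eqP ->; [exists 1 | exists (- 1)];
      by rewrite ?sqrrN ?expr1n ?mul1r ?mulN1r.
  have de : d = e * c by rewrite ce mulrA -expr2 e2 mul1r.
  have BA : B = e * A.
    rewrite EA EB; transitivity (e * c + e * d * v ^+ 3); last by ring.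
    by rewrite -de -ce.
  case/eqP: (nonconstant_fABC hB hf e2 BA).
  rewrite -[RHS]mulr1 E1 EC.
  by transitivity (3%:R * v * (e * c + e * d * v)); [rewrite -de -ce | ring].
pose g1 := mobius 1 (iota v); pose g2 := mobius (iota c) (iota d).
have iota1 : 1 ^+ q = 1 :> L by rewrite expr1n.
have v21' : 1 ^+ 2 != iota v ^+ 2.
  by rewrite -(rmorph1 iota) iota_sqr expr1n eq_sym.
have cd' : iota c ^+ 2 != iota d ^+ 2 by rewrite iota_sqr.
have den1 x : x \in mu L q.+1 -> iota v * x + 1 != 0 by apply: mobius_den_neq0.
have den2 x : x \in mu L q.+1 -> iota d * x + iota c != 0.
  by apply: mobius_den_neq0.
have g1S x : x \in mu L q.+1 -> g1 x \in mu L q.+1 by apply: mobius_mu.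
have g13S x xS := cube_mu (g1S x xS).
exists (fun x => g2 (g1 x ^+ 3)); have injg :
    {in mu L q.+1 &, injective (fun x => g2 (g1 x ^+ 3))}.
  move=> x y xS yS /(mobius_inj cd' (den2 _ (g13S x xS)) (den2 _ (g13S y yS))).
  move/(cube_mu_inj q3 (g1S x xS) (g1S y yS)).
  exact: mobius_inj v21' (den1 x xS) (den1 y yS).
split=> // [x xS|]; last first.
  by apply: inj_imset_eq => // x xS; apply: mobius_mu; rewrite ?g13S.
exists (hABC_recip A B C), (hABC A B C).
(* The coefficient 1 in [h] and in its reciprocal is implicit; this puts its expression in [c], [d],
   [v] there. *)
have E1m y : y = 3%:R * iota v * (iota d * iota v + iota c) * y.
  by rewrite -(rmorph_nat iota) -!rmorphM -rmorphD -rmorphM /= -E1 rmorph1 mul1r.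
have hE : (map_poly iota (hABC A B C)).[x]
    = (iota v * x + 1) ^+ 3 * (iota d * g1 x ^+ 3 + iota c).
  rewrite /hABC !rmorphD /= !map_polyZ /= !map_polyXn map_polyX map_polyC /=.
  rewrite !(hornerD, hornerZ, hornerXn, hornerX, hornerC).
  rewrite [X in _ + X + _ = _]E1m EA EB EC.
  rewrite !(rmorphD, rmorphM, rmorphXn, rmorph_nat) /=.
  by rewrite /g1 /mobius; field; exact: den1.
have hrE : (map_poly iota (hABC_recip A B C)).[x]
    = (iota v * x + 1) ^+ 3 * (iota c * g1 x ^+ 3 + iota d).
  rewrite /hABC_recip !rmorphD /= !map_polyZ /= !map_polyXn map_polyX.
  rewrite map_polyC /= !(hornerD, hornerZ, hornerXn, hornerX, hornerC).
  rewrite [X in _ + X + _ + _ = _]E1m EA EB EC.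
  rewrite !(rmorphD, rmorphM, rmorphXn, rmorph_nat) /=.
  by rewrite /g1 /mobius; field; exact: den1.
have D0 := den2 _ (g13S x xS).
split; rewrite ?hE ?hrE ?mulf_neq0 ?expf_neq0 ?den1 //.
by rewrite -mulf_div divff ?expf_neq0 ?den1 // mul1r.
Qed.
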